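(* Consider the cache network on the $\sqrt n\times\sqrt n$ grid (torus) with $n$ servers, library size $K$, cache size $M$, and $n$ requests. Suppose that $K=n^{1-\epsilon}$ for some constant $0<\epsilon<1$, and $M=\Theta(1)$. Then, under the Uniform popularity distribution $\mathcal P$ ($p_i=1/K$ for all $i$), the Nearest Replica Strategy (Strategy I) achieves maximum load $L=\Theta(\log n)$ with high probability.
   Context: Network: $n$ servers are the vertices of a $\sqrt n\times\sqrt n$ grid graph $G$; to avoid boundary effects $G$ is taken to be the torus (wrap-around grid), the asymptotic results being asserted for the grid as well. $d_G(u,v)$ is the shortest-path distance. Library and placement: there are $K$ files $W_1,\dots,W_K$ with popularity distribution $\mathcal P=(p_1,\dots,p_K)$. Each server independently caches $M$ files drawn i.i.d. from $\mathcal P$ with replacement ($M\le K$, and throughout $M\ll K$). Requests: after placement, $n$ requests arrive sequentially; each request originates at a server chosen uniformly at random and asks for a file drawn from $\mathcal P$, independently. Strategy I (Nearest Replica Strategy): each request is assigned to the nearest node, in the graph distance $d_G$, that has cached the requested file; ties are broken randomly. Maximum load: if $T_i$ is the number of requests assigned to server $i$ after all $n$ requests, then $L=\max_{1\le i\le n}T_i$. Asymptotics are as $n\to\infty$ (integer rounding is ignored). ''With high probability'' means with probability at least $1-1/n^c$ for some constant $c>0$. *)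

(* Defs.v *)
From mathcomp Require Import all_boot all_order all_algebra.
From mathcomp Require Import reals.
Set Implicit Arguments.
Unset Strict Implicit.
Unset Printing Implicit Defensive.
Import Order.TTheory GRing.Theory Num.Theory.
Local Open Scope ring_scope.

(* Shortest-path distance: the least length of an e-path from u to v.  An
   e-path of least length has length < #|T|; the value is #|T| when v is not
   reachable from u. *)
Definition gdist (T : finType) (e : rel T) (u v : T) : nat :=
  find (fun k => [exists p : k.-tuple T, path e u p && (last u p == v)])
       (iota 0 #|T|).

Definition server (m : nat) : finType := ('I_m * 'I_m)%type.

(* ordS is the cyclic successor i |-> i.+1 %% m on 'I_m. *)
Definition cycle_adj (m : nat) : rel 'I_m :=
  fun i j => (j == ordS i) || (i == ordS j).

(* For m = 1 this has a loop, which does not affect distances. *)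
Definition torus (m : nat) : rel (server m) :=
  fun u v => ((u.1 == v.1) && cycle_adj u.2 v.2)
          || ((u.2 == v.2) && cycle_adj u.1 v.1).

(* x (v, j) is the content of the j-th cache slot of server v; as files are
   drawn with replacement, slots of the same server may hold the same file. *)
Definition placement (m K M : nat) : finType :=
  {ffun server m * 'I_M -> 'I_K}.

(* A request is its origin together with the requested file. *)
Definition request (m K : nat) : finType := (server m * 'I_K)%type.

(* The m ^ 2 requests, in order of arrival. *)
Definition requests (m K : nat) : finType := {ffun 'I_(m ^ 2) -> request m K}.

(* a t is the server to which the t-th request is assigned; None records that
   the requested file is cached nowhere, in which case the request is dropped. *)
Definition assignment (m : nat) : finType :=
  {ffun 'I_(m ^ 2) -> option (server m)}.

Definition outcome (m K M : nat) : finType :=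
  (placement m K M * requests m K * assignment m)%type.

Definition replicas (m K M : nat) (x : placement m K M) (f : 'I_K) :
    {set server m} :=
  [set v | [exists j, x (v, j) == f]].

Definition nearest_replicas (m K M : nat) (x : placement m K M)
    (q : request m K) : {set server m} :=
  [set v in replicas x q.2 |
    [forall w in replicas x q.2,
      (gdist (@torus m) q.1 v <= gdist (@torus m) q.1 w)%N]].

Definition placement_mass (R : realType) (m K M : nat) (p : 'I_K -> R)
    (x : placement m K M) : R :=
  \prod_s p (x s).

Definition requests_mass (R : realType) (m K : nat) (p : 'I_K -> R)
    (r : requests m K) : R :=
  \prod_t ((#|server m|%:R)^-1 * p (r t).2).

(* Nearest Replica Strategy: the conditional probability that request q goes to
   o given the placement x, ties being broken uniformly at random. *)
Definition nearest_replica_mass (R : realType) (m K M : nat)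
    (x : placement m K M) (q : request m K) (o : option (server m)) : R :=
  let N := nearest_replicas x q in
  if o is Some v then (v \in N)%:R / #|N|%:R else (N == set0)%:R.

Definition outcome_mass (R : realType) (m K M : nat) (p : 'I_K -> R)
    (w : outcome m K M) : R :=
  let: (x, r, a) := w in
  placement_mass p x * requests_mass p r
    * \prod_t nearest_replica_mass R x (r t) (a t).

Definition Prob (R : realType) (m K M : nat) (p : 'I_K -> R)
    (E : pred (outcome m K M)) : R :=
  \sum_(w | E w) outcome_mass p w.

Definition load (m K M : nat) (w : outcome m K M) (v : server m) : nat :=
  #|[set t | w.2 t == Some v]|.

Definition max_load (m K M : nat) (w : outcome m K M) : nat :=
  \max_(v : server m) load w v.

Definition uniform_popularity (R : realType) (K : nat) : 'I_K -> R :=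
  fun=> K%:R^-1.

(* Main.v *)
(* Given the placement x, the servers receiving the requests are i.i.d. with law
   route_mass x, so every load is binomial with mean n * route_mass x v, and
   E[2 ^ load] and E[2 ^ -load] give exponential tails: it suffices that with high
   probability over x all these means are O(log n) and one is Omega(log n).

   Upper bound: with d ^ 2 of order K log n, every d x d window contains every
   file, by a union bound.  Hence a server serves a given file only within distance
   2d, and it holds at most M files, so its mean is O(M d ^ 2 / K).

   Lower bound: fix one file f and cut the torus into squares of side 5r, with r ^ 2
   of order delta K log n.  If f has exactly one replica in a square, and it lies in
   the central r x r core, then this replica serves all requests for f from the
   core, and its mean is at least r ^ 2 / K.  A square has this property with
   probability at least n ^ (- eps / 4) r ^ 2 / K when delta is small, squares are
   independent, and there are about n / r ^ 2 of them, which makes n ^ (3 eps / 4)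
   good squares on average. *)
Require Import Defs.
From HB Require Import structures.
From mathcomp Require Import all_boot all_order all_algebra.
From mathcomp Require Import all_classical all_reals all_analysis.
From mathcomp Require Import zify ring lra.
Import Order.TTheory GRing.Theory Num.Theory.
Import numFieldNormedType.Exports.
Set Implicit Arguments.
Unset Strict Implicit.
Unset Printing Implicit Defensive.
Local Open Scope ring_scope.

(** * Product measures and independence of disjoint coordinates *)

Section ProductMass.
Variables (R : realType) (I V : finType) (p : V -> R).
Hypotheses (p_ge0 : forall v, 0 <= p v) (p_sum1 : \sum_v p v = 1).

Definition prod_mass (x : {ffun I -> V}) : R := \prod_i p (x i).

Lemma prod_mass_ge0 x : 0 <= prod_mass x.
Proof. exact: prodr_ge0. Qed.

Lemma sum_prod_mass_weighted (g : I -> V -> R) :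
  \sum_x prod_mass x * \prod_i g i (x i) = \prod_i \sum_v p v * g i v.
Proof. by rewrite bigA_distr_bigA; apply: eq_bigr => x _; rewrite -big_split. Qed.

Lemma sum_prod_mass : \sum_x prod_mass x = 1.
Proof.
rewrite -[LHS](bigA_distr_bigA (fun (_ : I) v => p v)).
by rewrite big1.
Qed.

Definition splice (A : {set I}) (x y : {ffun I -> V}) : {ffun I -> V} :=
  [ffun i => if i \in A then x i else y i].

(* Exchanging off A the coordinates of two independent samples is an involution
   that preserves their joint mass. *)
Lemma prod_mass_indep (A : {set I}) (E F : {ffun I -> V} -> R) :
  (forall x y : {ffun I -> V}, {in A, x =1 y} -> E x = E y) ->
  (forall x y : {ffun I -> V}, {in ~: A, x =1 y} -> F x = F y) ->
  \sum_x prod_mass x * (E x * F x) =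
  (\sum_x prod_mass x * E x) * (\sum_x prod_mass x * F x).
Proof.
move=> hE hF.
pose sw (z : {ffun I -> V} * {ffun I -> V}) := (splice A z.1 z.2, splice A z.2 z.1).
have swK : involutive sw.
  move=> [x y]; rewrite /sw /=.
  by apply: f_equal2; apply/ffunP => i; rewrite !ffunE; case: (i \in A).
have mE x y : E (splice A x y) = E x by apply: hE => i iA; rewrite ffunE iA.
have mF x y : F (splice A y x) = F x.
  by apply: hF => i; rewrite inE ffunE => /negbTE->.
have mP x y : prod_mass (splice A x y) * prod_mass (splice A y x) =
              prod_mass x * prod_mass y.
  rewrite /prod_mass -!big_split /=; apply: eq_bigr => i _.
  by rewrite !ffunE; case: (i \in A); rewrite // mulrC.
(* The left side is multiplied by the total mass 1 of a second sample, so that both sides become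
   sums over pairs. *)
rewrite -[LHS]mulr1 -[X in _ * X = _]sum_prod_mass !big_distrlr /= !pair_big /=.
rewrite [RHS](reindex_inj (inv_inj swK)) /=; apply: eq_bigr => -[x y] _ /=.
by rewrite mE mF mulrACA mP; ring.
Qed.

(** Induction on the indices: the remaining factors depend only on coordinates outside [B j], so the
    two-factor case applies. *)
Lemma prod_mass_indep_big (J : finType) (B : J -> {set I})
    (E : J -> {ffun I -> V} -> R) :
  (forall j k, j != k -> [disjoint B j & B k]) ->
  (forall j (x y : {ffun I -> V}), {in B j, x =1 y} -> E j x = E j y) ->
  \sum_x prod_mass x * \prod_j E j x = \prod_j \sum_x prod_mass x * E j x.
Proof.
move=> dB hE; have := index_enum_uniq J.
elim: (index_enum J) => [_|j s IH /= /andP[js us]].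
  by rewrite big_nil; under eq_bigr do rewrite big_nil mulr1; rewrite sum_prod_mass.
rewrite big_cons -IH//; under eq_bigr do rewrite big_cons.
apply: (prod_mass_indep (A := B j)); first exact: hE.
move=> x y xy; apply: eq_big_seq => k ks; apply: hE => i iBk; apply: xy.
have /dB/disjointFl/(_ iBk) : j != k by apply: contraNneq js => ->.
by rewrite inE => ->.
Qed.

Lemma prod_mass_family (F : I -> {pred V}) :
  \sum_(x : {ffun I -> V} | [forall i, x i \in F i]) prod_mass x = \prod_i \sum_(v in F i) p v.
Proof.
rewrite bigA_distr_big_dep /=; apply: eq_bigl => x.
by rewrite unfold_in.
Qed.

End ProductMass.

(** * Exponential tails of binomial counts *)

Section Tail.
Variables (R : realType) (O : finType) (Q : O -> R) (n : nat).
Hypotheses (Q_ge0 : forall o, 0 <= Q o) (Q_sum1 : \sum_o Q o = 1).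

Definition hits (o : O) (a : {ffun 'I_n -> O}) : nat := #|[set t | a t == o]|.

(** The power of [z] is a product of one factor per trial, so its expectation factorizes into the
    binomial generating function. *)
Lemma hits_pgf (z : R) (o : O) :
  \sum_a prod_mass Q a * z ^+ hits o a = (1 + Q o * (z - 1)) ^+ n.
Proof.
transitivity (\sum_a prod_mass Q a *
                \prod_(t < n) (if a t == o then z else 1)).
  apply: eq_bigr => a _; congr (_ * _).
  by rewrite -big_mkcond /= prodr_const /hits cardsE.
rewrite (sum_prod_mass_weighted Q (fun _ v => if v == o then z else 1)).
rewrite prodr_const card_ord; congr (_ ^+ _).
rewrite -[Q o * _](big_pred1_eq +%R o (fun v => Q v * (z - 1))) -[X in X + _]Q_sum1.
rewrite [in RHS]big_mkcond -big_split; apply: eq_bigr => v _ /=.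
by case: eqP => _; ring.
Qed.

(** Markov's inequality for [2 ^+ hits o a]: the base 2 dominates [expR (1 / 2)], hence the rate
    [s / 2]. *)
Lemma hits_upper_tail (o : O) (mu s : R) : n%:R * Q o <= mu ->
  \sum_(a | s < (hits o a)%:R) prod_mass Q a <= expR (mu - s / 2).
Proof.
move=> hmu.
have h2 : expR (1 / 2) <= 2 :> R.
  have := @expR_ge1Dx R (- (1 / 2)); rewrite expRN => h.
  rewrite -[leRHS]invrK -[leLHS]invrK lef_pV2 ?posrE ?invr_gt0 ?expR_gt0//.
  by apply: le_trans h; lra.
have bound (a : {ffun 'I_n -> O}) : s < (hits o a)%:R ->
    1 <= expR (- (s / 2)) * 2 ^+ hits o a :> R.
  move=> hs; apply: (@le_trans _ _ (expR (- (s / 2)) * expR (1 / 2) ^+ hits o a)).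
    rewrite -expRM_natl -expRD -[leLHS]expR0 ler_expR; lra.
  by rewrite ler_pM2l ?expR_gt0// lerXn2r// nnegrE ?expR_ge0.
apply: (@le_trans _ _ (expR (- (s / 2)) * \sum_a prod_mass Q a * 2 ^+ hits o a)).
  rewrite big_distrr/= [leRHS](bigID (fun a => s < (hits o a)%:R)) /= -[leLHS]addr0.
  apply: lerD.
    apply: ler_sum => a /bound h; rewrite mulrCA -[leLHS]mulr1.
    by rewrite ler_wpM2l// prod_mass_ge0.
  apply: sumr_ge0 => a _; rewrite mulr_ge0 ?expR_ge0// mulr_ge0 ?exprn_ge0//.
  exact: prod_mass_ge0.
rewrite hits_pgf [mu - _]addrC expRD ler_pM2l ?expR_gt0//.
apply: (@le_trans _ _ (expR (Q o) ^+ n)).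
  rewrite lerXn2r ?nnegrE ?expR_ge0//.
    by have := Q_ge0 o; lra.
  by apply: le_trans (expR_ge1Dx _); lra.
by rewrite -expRM_natl ler_expR.
Qed.

(** Markov's inequality with base [1 / 2], which is at least [expR (- 1)]. *)
Lemma hits_lower_tail (o : O) (mu s : R) : mu <= n%:R * Q o ->
  \sum_(a | (hits o a)%:R < s) prod_mass Q a <= expR (s - mu / 2).
Proof.
move=> hmu.
have h2 : expR (- 1) <= 1 / 2 :> R.
  have := @expR_ge1Dx R 1; rewrite expRN => h.
  rewrite -[leRHS]invrK lef_pV2 ?posrE ?invr_gt0 ?expR_gt0//; lra.
have bound (a : {ffun 'I_n -> O}) : (hits o a)%:R < s ->
    1 <= expR s * (1 / 2) ^+ hits o a :> R.
  move=> hs; apply: (@le_trans _ _ (expR s * expR (- 1) ^+ hits o a)).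
    rewrite -expRM_natl -expRD -[leLHS]expR0 ler_expR; lra.
  by rewrite ler_pM2l ?expR_gt0// lerXn2r// nnegrE ?expR_ge0//; lra.
apply: (@le_trans _ _ (expR s * \sum_a prod_mass Q a * (1 / 2) ^+ hits o a)).
  rewrite big_distrr/= [leRHS](bigID (fun a => (hits o a)%:R < s)) /= -[leLHS]addr0.
  apply: lerD.
    apply: ler_sum => a /bound h; rewrite mulrCA -[leLHS]mulr1.
    by rewrite ler_wpM2l// prod_mass_ge0.
  apply: sumr_ge0 => a _; rewrite mulr_ge0 ?expR_ge0// mulr_ge0//.
  exact: prod_mass_ge0.
rewrite hits_pgf expRD ler_pM2l ?expR_gt0//.
have Q1 : Q o <= 1.
  by rewrite -Q_sum1 (bigD1 o)//= lerDl sumr_ge0.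
apply: (@le_trans _ _ (expR (- (Q o / 2)) ^+ n)).
  rewrite lerXn2r ?nnegrE ?expR_ge0//.
    by have := Q_ge0 o; lra.
  by apply: le_trans (expR_ge1Dx _); lra.
by rewrite -expRM_natl ler_expR; lra.
Qed.
End Tail.

(** * Graph distance on the torus as a sum of two cyclic distances *)

Section TorusDistance.

(** Length of the shorter arc of the cycle; with truncated subtraction, [i - j + (j - i)] is the
    absolute difference. *)
Definition cdist (m i j : nat) : nat := minn (i - j + (j - i)) (m - (i - j + (j - i))).

Definition tdist (m : nat) (u v : server m) : nat :=
  (cdist m u.1 v.1 + cdist m u.2 v.2)%N.

Lemma val_ordS (m : nat) (i : 'I_m) :
  ordS i = (if (i.+1 < m)%N then i.+1 else 0) :> nat.
Proof.
case: ifP => h /=; first by rewrite modn_small.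
have -> : i.+1 = m by have := ltn_ord i; lia.
by rewrite modnn.
Qed.

Lemma cdist_adj (m : nat) (i j k : 'I_m) :
  cycle_adj i j -> (cdist m i k <= (cdist m j k).+1)%N.
Proof.
rewrite /cdist /cycle_adj; have := ltn_ord i; have := ltn_ord j; have := ltn_ord k.
by move=> ? ? ? /orP[]/eqP/(congr1 (@nat_of_ord m)); rewrite val_ordS; case: ifP; lia.
Qed.

Lemma cdist_descent (m : nat) (i k : 'I_m) : (0 < cdist m i k)%N ->
  exists2 j : 'I_m, cycle_adj i j & cdist m i k = (cdist m j k).+1.
Proof.
have := ltn_ord i; have := ltn_ord k => hk hi h.
(* The test holds when the arc starting with [ordS i] is no longer than the other. *)
have [fwd|bwd] := boolP (((i < k) && (k - i <= m - (k - i)))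
                         || ((k < i) && (m - (i - k) <= i - k)))%N.
  exists (ordS i); first by rewrite /cycle_adj eqxx.
  by move: fwd h; rewrite /cdist val_ordS; case: ifP; lia.
have hp : ((if val i == 0 then m.-1 else i.-1) < m)%N by case: eqP; lia.
have ordSp : i = ordS (Ordinal hp).
  by apply: val_inj; rewrite [RHS]val_ordS /=; case: eqP; case: ifP; lia.
exists (Ordinal hp); first by rewrite /cycle_adj -ordSp eqxx orbT.
by move: bwd h; rewrite /cdist /=; case: eqP; lia.
Qed.

Lemma tdist_path (m : nat) (v : server m) (s : seq (server m)) (u : server m) :
  path (@torus m) u s -> last u s = v -> (tdist u v <= size s)%N.
Proof.
elim: s u => [u _ /= ->|w s IH u /= /andP[uw ws] lv].
  by rewrite /tdist /cdist !subnn !min0n.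
apply: leq_trans (_ : (tdist w v).+1 <= _)%N; last by rewrite ltnS IH.
rewrite /tdist; move: uw => /orP[]/andP[/eqP -> h].
  by rewrite -addnS leq_add2l cdist_adj.
by rewrite -addSn leq_add2r cdist_adj.
Qed.

Lemma path_tdist (m k : nat) (u v : server m) : tdist u v = k ->
  exists2 s : k.-tuple (server m), path (@torus m) u s & last u s = v.
Proof.
elim: k u => [u h|k IH u h].
  exists [tuple] => //=; case: u v h => [u1 u2] [v1 v2]; rewrite /tdist /cdist /=.
  have := ltn_ord u1; have := ltn_ord v1; have := ltn_ord u2; have := ltn_ord v2.
  by move=> *; congr (_, _); apply: val_inj => /=; lia.
suff [w uw hw] : exists2 w, @torus m u w & tdist w v = k.
  by have [s ps ls] := IH _ hw; exists [tuple of w :: s] => //=; rewrite uw.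
have [h1|h1] := posnP (cdist m u.1 v.1).
  have [|j uj hj] := @cdist_descent m u.2 v.2.
    by move: h; rewrite /tdist h1 add0n => ->.
  by exists (u.1, j); [rewrite /torus /= eqxx uj|move: h; rewrite /tdist /= hj addnS => -[]].
have [j uj hj] := cdist_descent h1.
exists (j, u.2); first by rewrite /torus /= eqxx uj orbT.
by move: h; rewrite /tdist /= hj addSn => -[].
Qed.

(** Each edge changes [tdist] by at most one, so no path is shorter, and stepping along shorter arcs
    attains it. *)
Lemma gdist_torus (m : nat) (u v : server m) : gdist (@torus m) u v = tdist u v.
Proof.
(* [gdist] searches only lengths below the number of servers; this puts [tdist u v] inside that
   range. *)
have tdlt : (tdist u v < #|server m|)%N.
  rewrite card_prod !card_ord /tdist /cdist.
  have := ltn_ord u.1; have := ltn_ord v.1; have := ltn_ord u.2; have := ltn_ord v.2.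
  by nia.
rewrite /gdist; set a := fun k => _.
have aP k : reflect (exists2 s : k.-tuple (server m),
    path (@torus m) u s & last u s = v) (a k).
  apply: (iffP existsP) => [[s /andP[p /eqP l]]|[s p l]]; exists s => //.
  by rewrite p l eqxx.
have hat : a (tdist u v) by apply/aP; exact: path_tdist.
have hh : has a (iota 0 #|server m|).
  by apply/hasP; exists (tdist u v) => //; rewrite mem_iota.
apply/eqP; rewrite eqn_leq; apply/andP; split.
  rewrite leqNgt; apply/negP => /(before_find 0).
  by rewrite nth_iota// add0n hat.
have := nth_find 0 hh; rewrite nth_iota ?add0n; last by rewrite -[X in (_ < X)%N](size_iota 0) -has_find.
by move=> /aP[s ps ls]; have := tdist_path ps ls; rewrite size_tuple.
Qed.

Lemma card_cball (m k : nat) (j : 'I_m) :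
  (#|[set i : 'I_m | (cdist m i j <= k)%N]| <= k.*2.+1)%N.
Proof.
have := ltn_ord j => hj.
(* Unrolls the arc around [j]: on the ball the value is congruent to [i - j + k] modulo [m], whence
   injectivity. *)
pose f (i : 'I_m) : 'I_(k.*2.+1) :=
  inord (if i + k < j then i + m + k - j
         else if i <= j + k then i + k - j else i + k - j - m)%N.
rewrite -(@card_in_imset _ _ f); first by rewrite -[leqRHS]card_ord max_card.
move=> i i'; rewrite !inE /f /cdist => hi hi' /(congr1 (@nat_of_ord _)).
have := ltn_ord i; have := ltn_ord i' => li' li.
rewrite !inordK; last 2 first.
- by case: ifP => ?; [lia|case: ifP; lia].
- by case: ifP => ?; [lia|case: ifP; lia].
by move=> e; apply: val_inj => /=; move: e;
  do 4! (case: ifP => ?; try lia).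
Qed.

Lemma card_ord_interval (m a k : nat) : (a + k <= m)%N ->
  #|[set i : 'I_m | (a <= i < a + k)%N]| = k.
Proof.
move=> h; pose f (t : 'I_k) : 'I_m := widen_ord h (rshift a t).
have fI : injective f by move=> s t /(congr1 val) /= /addnI/val_inj.
rewrite -[RHS]card_ord -[RHS](card_imset _ fI); apply: eq_card => i; rewrite inE.
apply/idP/imsetP => [hi|[t _ ->] /=]; last by have := ltn_ord t; lia.
have hk : (i - a < k)%N by lia.
by exists (Ordinal hk) => //; apply: val_inj => /=; lia.
Qed.

End TorusDistance.

(** * Law of the destination of a request, given the placement *)

Section Routing.
Variables (R : realType) (m K M : nat).
Hypotheses (m_gt0 : (0 < m)%N) (K_gt0 : (0 < K)%N).
Local Notation U := (@uniform_popularity R K).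

Lemma uniform_popularity_ge0 f : 0 <= U f.
Proof. by rewrite /uniform_popularity invr_ge0 ler0n. Qed.

Lemma sum_uniform_popularity : \sum_f U f = 1.
Proof.
by rewrite sumr_const card_ord -[LHS]mulr_natl mulfV// pnatr_eq0 -lt0n.
Qed.

Lemma nearest_replica_mass_ge0 (x : placement m K M) q o :
  0 <= nearest_replica_mass R x q o.
Proof. by case: o => [v|]; rewrite /nearest_replica_mass ?divr_ge0// ler0n. Qed.

Lemma sum_nearest_replica_mass (x : placement m K M) q :
  \sum_o nearest_replica_mass R x q o = 1.
Proof.
rewrite /nearest_replica_mass; set N := nearest_replicas x q.
rewrite (bigD1 None)//= [X in _ + X](reindex_omap Some id) /=; last by case.
under eq_bigl => v do rewrite eqxx.
rewrite -big_distrl/= -natr_sum -big_mkcond/= sum1_card.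
have [->|N0] := eqVneq N finset.set0; first by rewrite cards0 mul0r addr0.
by rewrite add0r mulfV// pnatr_eq0 cards_eq0.
Qed.

(** Law of the server receiving one request for a fixed placement, averaged over origin, file and
    tie-breaking. *)
Definition route_mass (x : placement m K M) (o : option (server m)) : R :=
  \sum_(q : request m K)
    #|server m|%:R^-1 * U q.2 * nearest_replica_mass R x q o.

Lemma route_mass_ge0 x o : 0 <= route_mass x o.
Proof.
apply: sumr_ge0 => q _; rewrite mulr_ge0 ?nearest_replica_mass_ge0// mulr_ge0//.
exact: uniform_popularity_ge0.
Qed.

Lemma sum_route_mass x : \sum_o route_mass x o = 1.
Proof.
rewrite exchange_big /=.
under eq_bigr => q _ do rewrite -big_distrr /= sum_nearest_replica_mass mulr1.
rewrite -(pair_big xpredT xpredT (fun (_ : server m) f => #|server m|%:R^-1 * U f)) /=.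
under eq_bigr => u _ do rewrite -big_distrr /= sum_uniform_popularity mulr1.
rewrite sumr_const -[LHS]mulr_natl mulfV// pnatr_eq0 -lt0n.
by rewrite card_prod card_ord muln_gt0 m_gt0.
Qed.

(** Requests and tie-breaks are independent over time, so summing out the requests leaves i.i.d.
    destinations given the placement. *)
Lemma ProbE (E : pred (assignment m)) :
  Prob U (fun w : outcome m K M => E w.2) =
  \sum_x prod_mass U x * \sum_(a | E a) prod_mass (route_mass x) a.
Proof.
transitivity (\sum_(x : placement m K M) \sum_r \sum_(a | E a) outcome_mass U ((x, r), a)).
  by rewrite !pair_big /=; apply: eq_big => -[[x r] a].
apply: eq_bigr => x _; rewrite exchange_big /= big_distrr /=; apply: eq_bigr => a _.
rewrite /prod_mass /route_mass bigA_distr_bigA big_distrr /=; apply: eq_bigr => r _.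
by rewrite /requests_mass /placement_mass -mulrA; congr (_ * _); rewrite -big_split.
Qed.

Lemma scaled_route_mass x o :
  (m ^ 2)%:R * route_mass x o = K%:R^-1 * \sum_q nearest_replica_mass R x q o.
Proof.
rewrite /route_mass !big_distrr; apply: eq_bigr => q _ /=.
rewrite card_prod card_ord mulnn !mulrA mulfV ?mul1r//.
by rewrite pnatr_eq0 expn_eq0 negb_and -lt0n m_gt0.
Qed.

(** A request that [v] may serve starts within [d] of [v] and asks for one of its at most [M] files;
    each contributes at most 1 to the sum. *)
Lemma route_mass_upper (x : placement m K M) (d : nat) (v : server m) :
  (forall u f, exists2 w, w \in replicas x f & (tdist u w <= d)%N) ->
  (m ^ 2)%:R * route_mass x (Some v) <= (M * d.*2.+1 ^ 2)%:R / K%:R.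
Proof.
move=> hx; rewrite scaled_route_mass mulrC ler_wpM2r ?invr_ge0 ?ler0n//.
pose B := finset.setX [set i : 'I_m | (cdist m i v.1 <= d)%N]%SET
             [set i : 'I_m | (cdist m i v.2 <= d)%N]%SET.
pose C : {set 'I_K} := [set x (v, j) | j : 'I_M]%SET.
apply: (@le_trans _ _ #|finset.setX B C|%:R); last first.
  rewrite ler_nat !cardsX mulnC leq_mul//.
    by rewrite -[leqRHS](card_ord M) leq_imset_card.
  by rewrite -mulnn leq_mul ?card_cball.
rewrite -sum1_card natr_sum [leLHS](bigID (mem (finset.setX B C))) /= -[leRHS]addr0 lerD//.
  apply: ler_sum => q _; set N := nearest_replicas x q.
  have [vN|_] := boolP (v \in N); last by rewrite mul0r.
  rewrite mul1r invf_le1 ?ler1n ?ltr0n; apply/card_gt0P; exists v => //.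
rewrite big1// => q hq; rewrite /nearest_replica_mass.
case: (boolP (v \in _)) => [|_]; last by rewrite mul0r.
rewrite inE => /andP[vq /forall_inP vnear]; case/negP: hq; rewrite !inE /=.
have [w wq dw] := hx q.1 q.2.
have := leq_trans (vnear w wq); rewrite !gdist_torus => /(_ _ dw) dv.
move: (vq); rewrite inE => /existsP[j /eqP xj].
rewrite -andbA; apply/and3P; split.
- by apply: leq_trans dv; exact: leq_addr.
- by apply: leq_trans dv; exact: leq_addl.
- by apply/imsetP; exists j.
Qed.

Lemma route_mass_lower (x : placement m K M) (f : 'I_K) (v : server m)
    (A : {set server m}) :
  (forall u, u \in A -> nearest_replicas x (u, f) = finset.set1 v) ->
  #|A|%:R / K%:R <= (m ^ 2)%:R * route_mass x (Some v).
Proof.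
move=> hA; rewrite scaled_route_mass mulrC ler_wpM2l ?invr_ge0 ?ler0n//.
have inj : injective (fun u : server m => (u, f)) by move=> u w [].
rewrite -(card_imset A inj) -sum1_card natr_sum.
rewrite [leRHS](bigID (mem [set (u, f) | u in A]%SET)) /= -[leLHS]addr0 lerD//.
  apply: ler_sum => q /imsetP[u uA ->].
  by rewrite /nearest_replica_mass hA// finset.inE eqxx cards1 divr1.
by apply: sumr_ge0 => q _; rewrite divr_ge0 ?ler0n.
Qed.

End Routing.

(** * Probability that every window contains every file *)

Section Placement.
Variables (R : realType) (m K M : nat).
Local Notation U := (@uniform_popularity R K).
Implicit Types (x : placement m K M) (f : 'I_K).

Definition slots (S : {set server m}) : {set server m * 'I_M} :=
  [set s | s.1 \in S]%SET.

Lemma card_slots S : #|slots S| = (#|S| * M)%N.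
Proof.
rewrite -[M in RHS]card_ord -cardsT -cardsX; apply: eq_card => s.
by rewrite !inE andbT.
Qed.

(* First row (or column) of a window of length d that contains i and does not
   wrap around the torus. *)
Definition cell_start (d i : nat) : nat := minn i (m - d).

Definition cell (d : nat) (u : server m) : {set server m} :=
  finset.setX [set i : 'I_m | (cell_start d u.1 <= i < cell_start d u.1 + d)%N]%SET
    [set i : 'I_m | (cell_start d u.2 <= i < cell_start d u.2 + d)%N]%SET.

Lemma card_cell d u : (d <= m)%N -> #|cell d u| = (d ^ 2)%N.
Proof.
move=> dm; rewrite cardsX !card_ord_interval ?mulnn//; rewrite /cell_start; lia.
Qed.

Lemma tdist_cell d u w : w \in cell d u -> (tdist u w <= d.*2)%N.
Proof.
rewrite !inE /tdist /cdist /cell_start.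
have := ltn_ord u.1; have := ltn_ord u.2; have := ltn_ord w.1; have := ltn_ord w.2.
by move=> ? ? ? ? /andP[? ?]; lia.
Qed.

Definition covered (d : nat) x : bool :=
  [forall u, forall f, exists w in replicas x f, (tdist u w <= d)%N].

Hypothesis K_gt0 : (0 < K)%N.

(** The event constrains each slot separately, so its mass is a product over slots. *)
Lemma prob_hit_avoid (H S : {set server m * 'I_M}) f : [disjoint H & S] ->
  \sum_(x : placement m K M |
      [forall s in H, x s == f] && [forall s in S, x s != f]) prod_mass U x =
  K%:R^-1 ^+ #|H| * (1 - K%:R^-1) ^+ #|S|.
Proof.
move=> dHS.
pose F (s : server m * 'I_M) : {pred 'I_K} :=
  if s \in H then pred1 f else if s \in S then predC1 f else predT.
transitivity (\sum_(x : placement m K M | [forall s, x s \in F s]) prod_mass U x).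
  apply: eq_bigl => x; apply/andP/forallP => [[/forall_inP h /forall_inP a] s|h].
    rewrite /F; have [/h//|_] := boolP (s \in H).
    by have [/a xs|_] := boolP (s \in S); rewrite inE.
  split; apply/forall_inP => s sin; have := h s; rewrite /F.
    by rewrite sin.
  by rewrite (disjointFl dHS sin) sin.
rewrite prod_mass_family.
transitivity (\prod_s ((if s \in H then K%:R^-1 else 1) *
                       (if s \in S then 1 - K%:R^-1 else 1)) : R).
  apply: eq_bigr => s _; rewrite /F.
  have sumf : U f + \sum_(v | v != f) U v = 1.
    by rewrite -(sum_uniform_popularity R K_gt0) [RHS](bigD1 f).
  case: ifPn => [sH|_].
    by rewrite (disjointFr dHS sH) mulr1 big_pred1_eq.
  rewrite mul1r; case: ifPn => _; last exact: sum_uniform_popularity.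
  by apply/eqP; rewrite eq_sym subr_eq addrC -[X in X == _]sumf.
by rewrite big_split /= -!big_mkcond /= !prodr_const.
Qed.

(** Union bound over servers and files: a file with no replica within [d.*2] of [u] avoids all
    [d ^ 2 * M] slots of [cell d u]. *)
Lemma prob_uncovered d : (d <= m)%N ->
  \sum_(x : placement m K M | ~~ covered d.*2 x) prod_mass U x <=
  (m ^ 2 * K)%:R * (1 - K%:R^-1) ^+ (d ^ 2 * M).
Proof.
move=> dm.
pose E (q : request m K) x := [forall s in slots (cell d q.1), x s != q.2].
have PE q : \sum_(x | E q x) prod_mass U x = (1 - K%:R^-1) ^+ (d ^ 2 * M).
  have := @prob_hit_avoid finset.set0 (slots (cell d q.1)) q.2.
  rewrite cards0 expr0 mul1r card_slots card_cell// => <-; last first.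
    by rewrite -setI_eq0 finset.set0I.
  apply: eq_bigl => x; rewrite /E; case: forall_inP; rewrite ?andbF ?andbT//.
  by move=> _; symmetry; apply/forall_inP => s; rewrite inE.
apply: (@le_trans _ _ (\sum_(q : request m K) \sum_(x | E q x) prod_mass U x)).
  under [leRHS]eq_bigr => q _ do rewrite big_mkcond.
  rewrite exchange_big /= big_mkcond; apply: ler_sum => x _.
  have pm0 : 0 <= prod_mass U x by apply: prod_mass_ge0; exact: uniform_popularity_ge0.
  case: ifPn => [|_]; last by apply: sumr_ge0 => q _; case: ifP.
  rewrite negb_forall => /existsP[u]; rewrite negb_forall => /existsP[f].
  rewrite negb_exists_in => /forall_inP hw.
  rewrite (bigD1 (u, f)) //= ifT ?lerDl; first by apply: sumr_ge0 => q _; case: ifP.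
  apply/forall_inP => s; rewrite inE /= => /tdist_cell sd; apply/negP => sf.
  suff /hw : s.1 \in replicas x f by rewrite sd.
  by rewrite inE; apply/existsP; exists s.2; rewrite -surjective_pairing.
rewrite (eq_bigr _ (fun q _ => PE q)) sumr_const -[leLHS]mulr_natl.
by rewrite !card_prod !card_ord mulnn.
Qed.

End Placement.

(** * Solitary replicas in disjoint regions *)

Section LargeCell.
Variables (R : realType) (m K M r g : nat).
Hypotheses (r_gt0 : (0 < r)%N) (gm : (g * (5 * r) <= m)%N).
Local Notation U := (@uniform_popularity R K).
Implicit Types (x : placement m K M) (f : 'I_K) (j : 'I_g * 'I_g).

(** Quotients by the side length make distinct regions visibly disjoint. *)
Definition region j : {set server m} :=
  [set u : server m | ((u.1 : nat) %/ (5 * r) == j.1)%N && ((u.2 : nat) %/ (5 * r) == j.2)%N]%SET.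

(* The margin of 2r around the core of a region exceeds twice r - 1, the distance
   bound between two core servers. *)
Definition core j : {set server m} :=
  finset.setX
    [set i : 'I_m | (j.1 * (5 * r) + r.*2 <= i < j.1 * (5 * r) + r.*2 + r)%N]%SET
    [set i : 'I_m | (j.2 * (5 * r) + r.*2 <= i < j.2 * (5 * r) + r.*2 + r)%N]%SET.

Lemma block_bound (a : 'I_g) : (a * (5 * r) + 5 * r <= m)%N.
Proof.
by apply: leq_trans gm; rewrite -mulSnr leq_mul2r ltn_ord orbT.
Qed.

Lemma divn_block (a i : nat) :
  (i %/ (5 * r) == a)%N = (a * (5 * r) <= i < a * (5 * r) + 5 * r)%N.
Proof.
have d0 : (0 < 5 * r)%N by rewrite muln_gt0.
by rewrite eqn_leq -[in LHS]ltnS ltn_divLR// leq_divRL// mulSnr andbC.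
Qed.

Lemma card_region j : #|region j| = ((5 * r) ^ 2)%N.
Proof.
have -> : region j = finset.setX
    [set i : 'I_m | (j.1 * (5 * r) <= i < j.1 * (5 * r) + 5 * r)%N]%SET
    [set i : 'I_m | (j.2 * (5 * r) <= i < j.2 * (5 * r) + 5 * r)%N]%SET.
  by apply/setP => u; rewrite !inE !divn_block.
by rewrite cardsX !card_ord_interval ?mulnn ?block_bound.
Qed.

Lemma card_core j : #|core j| = (r ^ 2)%N.
Proof.
have := block_bound j.1; have := block_bound j.2 => b1 b2.
by rewrite cardsX !card_ord_interval ?mulnn//; lia.
Qed.

Lemma core_sub j : {subset core j <= region j}.
Proof. by move=> u; rewrite !inE !divn_block; lia. Qed.

Lemma cdist_core (a i k : nat) :
  (a + r.*2 <= i < a + r.*2 + r)%N -> (a + r.*2 <= k < a + r.*2 + r)%N ->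
  (cdist m i k < r)%N.
Proof. by rewrite /cdist gtn_min => /andP[? ?] /andP[? ?]; apply/orP; left; lia. Qed.

(** Either arc from [i] to [k] crosses a margin of width [2r]; the arc through 0 does too, because
    the block does not wrap around. *)
Lemma cdist_outside (a i k : nat) : (a + 5 * r <= m)%N ->
  (a + r.*2 <= i < a + r.*2 + r)%N -> (k < m)%N ->
  ~~ (a <= k < a + 5 * r)%N -> (r.*2 < cdist m i k)%N.
Proof.
rewrite /cdist leq_min negb_and -ltnNge -leqNgt => ? /andP[? ?] ? /orP[] ?;
  by apply/andP; split; lia.
Qed.

Lemma core_nearer j u v w : u \in core j -> v \in core j -> w \notin region j ->
  (tdist u v < tdist u w)%N.
Proof.
rewrite !inE !divn_block /tdist => /andP[u1 u2] /andP[v1 v2].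
have near1 := cdist_core u1 v1; have near2 := cdist_core u2 v2.
move=> hw; apply: (@leq_trans r.*2.+1); first by rewrite ltnS -addnn leq_add// ltnW.
case/nandP: hw => hw.
  by apply: ltn_addr; exact: cdist_outside (block_bound j.1) u1 _ hw.
by apply: ltn_addl; exact: cdist_outside (block_bound j.2) u2 _ hw.
Qed.

(** Counting slots rather than servers makes this one hit and many avoidances, whose probability is
    an exact product. *)
Definition only_hit f j (s : server m * 'I_M) x : bool :=
  (x s == f) && [forall s' in slots M (region j) :\ s, x s' != f].

Definition solitary f j x : bool := [exists s in slots M (core j), only_hit f j s x].

(* The events only_hit f j s, for s in the core, are disjoint and equally likely;
   there are r ^ 2 * M of them. *)
Definition solitary_prob : R :=
  (r ^ 2 * M)%:R * (K%:R^-1 * (1 - K%:R^-1) ^+ ((5 * r) ^ 2 * M).-1).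

Lemma slots_core_sub j s : s \in slots M (core j) -> s \in slots M (region j).
Proof. by rewrite !(finset.in_set (fun s => s.1 \in _)); exact: core_sub. Qed.

(** Any replica on another server lies outside the region, hence is strictly farther from every core
    server. *)
Lemma solitary_nearest f j x : solitary f j x ->
  exists v, forall u, u \in core j -> nearest_replicas x (u, f) = finset.set1 v.
Proof.
case/existsP => -[v i] /andP[]; rewrite finset.in_set /= => vc /andP[xv /forall_inP hx].
have vrep : v \in replicas x f by rewrite inE; apply/existsP; exists i.
have out w : w \in replicas x f -> w != v -> w \notin region j.
  rewrite inE => /existsP[i' xw] wv; apply/negP => wr.
  suff /hx : (w, i') \in slots M (region j) :\ (v, i) by rewrite xw.
  rewrite finset.in_setD1 finset.in_set /= wr andbT.
  by apply: contraNneq wv => -[->].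
exists v => u uc; apply/setP => w; rewrite finset.in_set finset.in_set1 /=.
apply/andP/eqP => [[wrep /forall_inP wn]|->].
  apply/eqP; apply: contraT => wv.
  have := wn v vrep; rewrite !gdist_torus leqNgt.
  by rewrite (core_nearer uc vc (out _ wrep wv)).
split=> //; apply/forall_inP => w' w'rep; rewrite !gdist_torus.
have [->//|w'v] := eqVneq w' v.
exact/ltnW/(core_nearer uc vc (out _ w'rep w'v)).
Qed.


Hypothesis K_gt0 : (0 < K)%N.

Lemma prob_solitary f j :
  solitary_prob <= \sum_(x | solitary f j x) prod_mass U x.
Proof.
have Ps s : s \in slots M (core j) ->
    \sum_(x | only_hit f j s x) prod_mass U x =
    K%:R^-1 * (1 - K%:R^-1) ^+ ((5 * r) ^ 2 * M).-1.
  move=> sc; have := @prob_hit_avoid R m K M K_gt0 (finset.set1 s) (slots M (region j) :\ s)%SET f.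
  rewrite cards1 expr1.
  have := cardsD1 s (slots M (region j)).
  rewrite (slots_core_sub sc) card_slots card_region => -> /= <-; last first.
    by rewrite disjoints1 !inE eqxx.
  apply: eq_bigl => x; rewrite /only_hit; congr (_ && _).
  apply/idP/forall_inP => [xs s'|]; last by apply; rewrite inE.
  by rewrite inE => /eqP->.
have card_sum : solitary_prob =
    \sum_(s in slots M (core j)) \sum_(x | only_hit f j s x) prod_mass U x.
  by rewrite (eq_bigr _ Ps) sumr_const card_slots card_core -[RHS]mulr_natl.
rewrite card_sum; under eq_bigr do rewrite big_mkcond.
rewrite exchange_big [leRHS]big_mkcond; apply: ler_sum => x _ /=.
have pm0 : 0 <= prod_mass U x by apply: prod_mass_ge0; exact: uniform_popularity_ge0.
case: ifPn => [/existsP[s /andP[sc hs]]|]; last first.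
  rewrite negb_exists_in => /forall_inP h; rewrite big1// => s /h.
  by case: ifP.
(* Another slot [s'] cannot be the only hit, as [s] holds [f]; a single term survives. *)
rewrite (bigD1 s) //= hs big1 ?addr0// => s' /andP[sc' s's].
case: ifP => // /andP[_ /forall_inP h].
have := h s; rewrite !finset.in_setD1 eq_sym s's slots_core_sub// => /(_ isT).
by case/andP: hs => ->.
Qed.

Lemma solitary_local f j (x y : placement m K M) :
  {in slots M (region j), x =1 y} -> solitary f j x = solitary f j y.
Proof.
move=> xy; apply: eq_existsb => s.
have [sc|//] := boolP (s \in slots M (core j)).
rewrite /only_hit xy ?slots_core_sub//; congr (_ && (_ && _)).
apply: eq_forallb => s'; have [|//] := boolP (s' \in _).
by rewrite inE => /andP[_ /xy->].
Qed.

(** Regions use disjoint slots, so the failures are independent, each of probability at most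
    [1 - solitary_prob], hence at most [expR (- solitary_prob)]. *)
Lemma prob_no_solitary f :
  \sum_(x : placement m K M | ~~ [exists j, solitary f j x]) prod_mass U x <=
  expR (- ((g ^ 2)%:R * solitary_prob)).
Proof.
have -> : \sum_(x : placement m K M | ~~ [exists j, solitary f j x]) prod_mass U x =
    \sum_(x : placement m K M) prod_mass U x * \prod_j (~~ solitary f j x)%:R.
  rewrite big_mkcond; apply: eq_bigr => x _.
  rewrite negb_exists; case: forallP => [h|/forallP]; first by rewrite big1 ?mulr1// => j _; rewrite h.
  rewrite negb_forall => /existsP[j hj].
  by rewrite (bigD1 j)//= (negbTE hj) mul0r mulr0.
have := @prod_mass_indep_big R _ _ U (sum_uniform_popularity R K_gt0) _
   (fun j => slots M (region j)) (fun j x => (~~ solitary f j x)%:R).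
move=> ->; last 2 first.
- move=> j k jk; rewrite -setI_eq0; apply/eqP/setP => s; rewrite !inE.
  apply: contraNF jk => /andP[/andP[/eqP j1 /eqP j2] /andP[/eqP k1 /eqP k2]].
  case: j k j1 j2 k1 k2 => [a b] [c d] /= -> -> e1 e2.
  by apply/eqP; congr (_, _); apply: val_inj.
- by move=> j x y xy; rewrite (solitary_local f xy).
have -> : (g ^ 2)%N = #|{: 'I_g * 'I_g}| by rewrite card_prod !card_ord mulnn.
rewrite -mulrN expRM_natl -prodr_const; apply: ler_prod => j _.
have sumE : \sum_x prod_mass U x * (~~ solitary f j x)%:R =
    \sum_(x | ~~ solitary f j x) prod_mass U x.
  rewrite [RHS]big_mkcond; apply: eq_bigr => x _.
  by case: ifP; rewrite ?mulr1 ?mulr0.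
rewrite sumE sumr_ge0 /=; last first.
  by move=> x _; apply: prod_mass_ge0; exact: uniform_popularity_ge0.
have := sum_prod_mass (server m * 'I_M)%type (sum_uniform_popularity R K_gt0).
rewrite (bigID (solitary f j)) /=.
by have := prob_solitary f j; have := expR_ge1Dx (- solitary_prob); lra.
Qed.

End LargeCell.

(** * Two-sided bound on the maximum load for given parameters *)

Section MaxLoad.
Variables (R : realType) (m K M d r g : nat).
Hypotheses (m_gt0 : (0 < m)%N) (K_gt0 : (0 < K)%N) (r_gt0 : (0 < r)%N).
Hypotheses (dm : (d <= m)%N) (gm : (g * (5 * r) <= m)%N).
Local Notation U := (@uniform_popularity R K).

(** Too large a maximum puts some server above [hi], which costs a union bound; too small a maximum
    puts the solitary replica [v0] below [lo]. *)
Lemma cond_max_load (x : placement m K M) (f : 'I_K) (lo hi : R) :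
  covered d.*2 x -> [exists j : 'I_g * 'I_g, solitary r f j x] ->
  \sum_(a : {ffun 'I_(m ^ 2) -> option (server m)} |
      ~~ (lo <= (\max_v hits (Some v) a)%:R <= hi))
    prod_mass (route_mass R x) a <=
  (m ^ 2)%:R * expR ((M * d.*2.*2.+1 ^ 2)%:R / K%:R - hi / 2)
  + expR (lo - (r ^ 2)%:R / K%:R / 2).
Proof.
move=> cov /existsP[j /(solitary_nearest r_gt0 gm)[v0 hv0]].
set Q := route_mass R x.
have Q0 : forall o, 0 <= Q o by exact: route_mass_ge0.
have Q1 : \sum_o Q o = 1 by exact: sum_route_mass.
have pm0 a : 0 <= prod_mass Q a by exact: prod_mass_ge0.
have up v : \sum_(a : {ffun 'I_(m ^ 2) -> _} | hi < (hits (Some v) a)%:R) prod_mass Q a <=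
    expR ((M * d.*2.*2.+1 ^ 2)%:R / K%:R - hi / 2).
  apply: hits_upper_tail => //; apply: route_mass_upper => // u f'.
  have /forallP/(_ u)/forallP/(_ f')/existsP[w /andP[wr wd]] := cov.
  by exists w.
have low : \sum_(a : {ffun 'I_(m ^ 2) -> _} | (hits (Some v0) a)%:R < lo) prod_mass Q a <=
    expR (lo - (r ^ 2)%:R / K%:R / 2).
  apply: hits_lower_tail => //; rewrite -(card_core r_gt0 gm j).
  exact: route_mass_lower hv0.
apply: (@le_trans _ _ (\sum_(v : server m) \sum_(a : {ffun 'I_(m ^ 2) -> _} |
   hi < (hits (Some v) a)%:R) prod_mass Q a + \sum_(a : {ffun 'I_(m ^ 2) -> _} |
   (hits (Some v0) a)%:R < lo) prod_mass Q a)); last first.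
  apply: lerD => //; apply: le_trans (ler_sum _ (fun v _ => up v)) _.
  by rewrite sumr_const -[leLHS]mulr_natl card_prod card_ord mulnn.
under [X in _ <= X + _]eq_bigr do rewrite big_mkcond.
rewrite exchange_big /= big_mkcond [X in _ <= _ + X]big_mkcond -big_split.
apply: ler_sum => a _ /=.
have s0 : 0 <= \sum_(v : server m) (if hi < (hits (Some v) a)%:R then prod_mass Q a else 0).
  by apply: sumr_ge0 => v _; case: ifP.
have i0 : 0 <= (if (hits (Some v0) a)%:R < lo then prod_mass Q a else 0).
  by case: ifP.
case: ifP => [|_]; last exact: addr_ge0.
rewrite negb_and -!ltNge => /orP[h|h].
  rewrite [X in _ + X]ifT ?lerDr//; apply: le_lt_trans h.
  by rewrite ler_nat; exact: (bigop.leq_bigmax (F := fun v => hits (Some v) a)).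
have [|v hv] := @bigop.eq_bigmax (server m) (fun v => hits (Some v) a).
  by rewrite card_prod card_ord muln_gt0 m_gt0.
rewrite hv in h; rewrite (bigD1 v)//= h -addrA lerDl addr_ge0//.
by apply: sumr_ge0 => w _; case: ifP.
Qed.

Lemma prob_max_load (lo hi : R) :
  1 - ((m ^ 2 * K)%:R * (1 - K%:R^-1) ^+ (d ^ 2 * M)
       + expR (- ((g ^ 2)%:R * solitary_prob R K M r))
       + ((m ^ 2)%:R * expR ((M * d.*2.*2.+1 ^ 2)%:R / K%:R - hi / 2)
          + expR (lo - (r ^ 2)%:R / K%:R / 2))) <=
  Prob U (fun w : outcome m K M => lo <= (max_load w)%:R <= hi).
Proof.
pose E (a : assignment m) := lo <= (\max_v hits (Some v) a)%:R <= hi.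
rewrite (_ : Prob _ _ = Prob U (fun w : outcome m K M => E w.2))//.
rewrite ProbE//; set B := _%:R * expR _ + _.
have B0 : 0 <= B by rewrite addr_ge0// ?mulr_ge0 ?expR_ge0// ler0n.
have pm0 (x : placement m K M) : 0 <= prod_mass U x :> R.
  by apply: prod_mass_ge0; exact: uniform_popularity_ge0.
have pm1 : \sum_(x : placement m K M) prod_mass U x = 1 :> R.
  by apply: sum_prod_mass; exact: sum_uniform_popularity.
pose fail (x : placement m K M) := \sum_(a | ~~ E a) prod_mass (route_mass R x) a.
have failE x : \sum_(a | E a) prod_mass (route_mass R x) a = 1 - fail x.
  have := sum_prod_mass 'I_(m ^ 2) (sum_route_mass R m_gt0 K_gt0 x).
  by rewrite (bigID E) /= /fail => <-; rewrite addrK.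
have fail_le1 x : fail x <= 1.
  rewrite -subr_ge0 -failE; apply: sumr_ge0 => a _.
  by apply: prod_mass_ge0; exact: route_mass_ge0.
pose f0 : 'I_K := Ordinal K_gt0.
rewrite lerBlDr -lerBlDl.
under eq_bigr => x _ do rewrite failE mulrBr mulr1.
rewrite sumrB pm1 opprB addrCA subrr addr0.
have u := prob_uncovered R M K_gt0 dm.
have i := prob_no_solitary R M r_gt0 gm K_gt0 f0.
apply: le_trans (lerD (lerD u i) (lexx B)).
(* [B] is spread over all placements for a termwise comparison: a bad placement is charged its whole
   mass, a good one the bound of [cond_max_load]. *)
rewrite -[B]mul1r -pm1 big_distrl /= [X in _ <= X + _ + _]big_mkcond.
rewrite [X in _ <= _ + X + _]big_mkcond -!big_split; apply: ler_sum => x _ /=.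
have c0 : 0 <= prod_mass U x * B by exact: mulr_ge0.
have h1 : prod_mass U x * fail x <= prod_mass U x by rewrite -[leRHS]mulr1 ler_wpM2l.
case: ifPn => [_|]; first by case: ifP => _; have := pm0 x; lra.
rewrite negbK => cov; case: ifPn => [_|]; first by have := pm0 x; lra.
rewrite negbK => iso; rewrite !add0r ler_wpM2l//.
exact: cond_max_load iso.
Qed.

End MaxLoad.

(** * Asymptotic estimates and choice of the scales *)

Section Asymptotics.
Variable R : realType.
Implicit Types x y L a C : R.

(** Rounding the square root up adds at most 1, so at most doubles it. *)
Lemma nat_square_approx y : 1 <= y ->
  exists2 t : nat, (0 < t)%N & y <= (t ^ 2)%:R <= 4 * y.
Proof.
move=> y1; have y0 : 0 <= y by lra.
have s1 : 1 <= Num.sqrt y by rewrite -[leLHS]sqrtr1 ler_sqrt.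
have /andP[lo up] := truncn_itv (sqrtr_ge0 y).
exists (Num.truncn (Num.sqrt y)).+1 => //; rewrite natrX.
have ys := sqr_sqrtr y0; move: (Num.sqrt y) (Num.truncn _) ys lo up s1 => s t.
by rewrite -natr1 => ys lo up s1; apply/andP; split; nra.
Qed.

(** The quadratic term of the exponential series already beats the linear function. *)
Lemma expR_dominates a C : 0 < a -> exists L0, forall L, L0 <= L -> C * L <= expR (a * L).
Proof.
move=> a0; exists (`|C| * 2 / a ^+ 2) => L hL.
have L0 : 0 <= L by apply: le_trans hL; rewrite !mulr_ge0// invr_ge0 exprn_ge0// ltW.
apply: le_trans (expR_ge1Dxn 1 _); last by rewrite mulr_ge0// ltW.
have : `|C| * 2 <= L * a ^+ 2 by rewrite -ler_pdivrMr// exprn_gt0.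
move=> aL; have := ler_norm C.
rewrite (_ : 2`! = 2)%N// exprMn.
have -> : a ^+ 2 * L ^+ 2 = L * (L * a ^+ 2) by ring.
nra.
Qed.

(** In this range [(1 - x) * (1 + 2 * x)] is at least 1. *)
Lemma one_sub_ge_expR x : 0 <= x -> 2 * x <= 1 -> expR (- (2 * x)) <= 1 - x.
Proof.
move=> x0 x1; rewrite expRN -[leRHS]invrK lef_pV2 ?posrE ?invr_gt0 ?expR_gt0//; last lra.
apply: le_trans (expR_ge1Dx _); rewrite -div1r ler_pdivrMr; [nra|lra].
Qed.

Lemma avoid_le (k : R) (N : nat) : 1 <= k -> (1 - k^-1) ^+ N <= expR (- (N%:R / k)).
Proof.
move=> k1; have k0 : 0 < k by lra.
rewrite -mulrN expRM_natl lerXn2r ?nnegrE ?expR_ge0 ?subr_ge0 ?invf_le1//.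
exact: expR_ge1Dx.
Qed.

Lemma avoid_ge (k c : R) (N : nat) : 2 <= k -> 2 * N%:R <= c * k ->
  expR (- c) <= (1 - k^-1) ^+ N.-1.
Proof.
move=> k2 hc; have k0 : 0 < k by lra.
have K1 : 2 * k^-1 <= 1 by rewrite ler_pdivrMr//; lra.
have K1' : 0 <= k^-1 by rewrite invr_ge0 ltW.
apply: (@le_trans _ _ ((1 - k^-1) ^+ N)); last first.
  by apply: ler_wiXn2l; [lra|lra|exact: leq_pred].
apply: (@le_trans _ _ (expR (- (2 * k^-1)) ^+ N)).
  by rewrite -expRM_natl ler_expR mulrN lerN2 mulrA ler_pdivrMr// [_ * 2]mulrC.
by rewrite lerXn2r ?nnegrE ?expR_ge0//; [lra|exact: one_sub_ge_expR].
Qed.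

(** At most [expR (2 * L)] pairs of server and file, each failing with probability at most
    [expR (- (4 * L))]. *)
Lemma uncovered_decay (n k L : R) (N : nat) : 1 <= k -> 0 <= L -> 0 <= n ->
  n * k <= expR (2 * L) -> 4 * L * k <= N%:R ->
  n * k * (1 - k^-1) ^+ N <= expR (- L).
Proof.
move=> k1 L0 n0 nk hN; have k0 : 0 < k by lra.
apply: (@le_trans _ _ (expR (2 * L) * expR (- (4 * L)))); last first.
  by rewrite -expRD ler_expR; lra.
apply: ler_pM => //; first by rewrite mulr_ge0// ltW.
  by rewrite exprn_ge0// subr_ge0 invf_le1.
by apply: le_trans (avoid_le N k1) _; rewrite ler_expR lerN2 ler_pdivlMr.
Qed.

(** With [g] the quotient, [g >= 1] gives [m <= (g + 1) * 5r <= 10 * g * r]. *)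
Lemma grid_count (m r : nat) : (0 < r)%N -> (5 * r <= m)%N ->
  (m ^ 2 <= 10 ^ 2 * (m %/ (5 * r)) ^ 2 * r ^ 2)%N.
Proof.
move=> r0 rm; rewrite -!expnMn leq_exp2r//.
have r5 : (0 < 5 * r)%N by rewrite muln_gt0.
have g1 : (1 <= m %/ (5 * r))%N by rewrite divn_gt0.
apply: leq_trans (ltnW (ltn_ceil m r5)) _.
have -> : (10 * (m %/ (5 * r)) * r = (m %/ (5 * r)).*2 * (5 * r))%N by lia.
by rewrite leq_mul2r; apply/orP; right; lia.
Qed.

(* G regions of core area r2: the core area cancels, so that G * P(solitary) is of
   order n / k up to the factor q, which costs at most n ^ (eps / 4). *)
Lemma solitary_growth (n k E G r2 Mr q eps L : R) :
  0 < k -> k <= 2 * E -> 0 < E -> 0 <= L -> 1 <= Mr -> 0 <= n -> 0 <= G -> 0 <= r2 ->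
  E * expR (eps * L) = n -> n <= 100 * G * r2 ->
  200 * L <= expR (3 / 4 * eps * L) -> expR (- (eps / 4 * L)) <= q ->
  L <= G * (r2 * Mr * (k^-1 * q)).
Proof.
move=> k0 kE E0 L0 M1 n0 G0 r0 nE nG hL hq.
have -> : G * (r2 * Mr * (k^-1 * q)) = G * r2 * Mr * q / k by ring.
rewrite ler_pdivlMr//.
(* Here [n * expR (- (eps / 4 * L))] is [E * expR (3 / 4 * eps * L)], which is at least
   [200 * E * L]. *)
apply: (@le_trans _ _ (n / 100 * expR (- (eps / 4 * L)))).
  rewrite -nE (_ : _ / _ * _ = E / 100 * (expR (eps * L) * expR (- (eps / 4 * L)))); last by ring.
  rewrite -expRD (_ : eps * L + _ = 3 / 4 * eps * L); last by field.
  apply: (@le_trans _ _ (L * (2 * E))); first by rewrite ler_wpM2l.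
  apply: (@le_trans _ _ (E / 100 * (200 * L))); first by clear; lra.
  by rewrite ler_wpM2l// divr_ge0// ltW.
apply: ler_pM; rewrite ?expR_ge0 ?divr_ge0//.
apply: (@le_trans _ _ (G * r2)); first by clear -nG; lra.
by rewrite ler_peMr// mulr_ge0.
Qed.

(** Non-asymptotic form: the last three hypotheses say how large [L] must be. *)
Lemma max_load_whp (eps B D n L : R) (m K M : nat) :
  n = (m ^ 2)%:R -> D = eps / (200 * B) -> 0 < eps -> eps < 1 ->
  (0 < m)%N -> L = ln n -> 1 <= L -> `|K%:R - n `^ (1 - eps)| < 1 ->
  (0 < M)%N -> M%:R <= B ->
  16 / D <= expR ((1 - eps) * L) ->
  200 * L <= expR (3 / 4 * eps * L) ->
  4 <= expR (D / 32 * L) ->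
  1 - expR (- (D / 32 * L)) <=
  Prob (@uniform_popularity R K) (fun w : outcome m K M =>
    D / 16 * L <= (max_load w)%:R <= 2 * (400 * B + 2) * L).
Proof.
move=> n_def D_def eps_gt0 eps_lt1 m_gt0 L_def L_ge1 K_def M_gt0 M_le L_K L_n L_D.
have n_gt0 : 0 < n by rewrite n_def ltr0n expn_gt0 m_gt0.
have nE : n = expR L by rewrite L_def lnK.
set E := expR ((1 - eps) * L) in L_K.
have powE : n `^ (1 - eps) = E by rewrite nE -expRM mulrC.
have M1 : 1 <= M%:R :> R by rewrite ler1n.
have B1 : 1 <= B by exact: le_trans M_le.
have B0 : 0 < B by exact: lt_le_trans B1.
have D0 : 0 < D by rewrite D_def divr_gt0// mulr_gt0.
have DB : D * B = eps / 200 by rewrite D_def; field; exact: lt0r_neq0.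
have D1 : D <= 1 / 200.
  have : D <= D * B by rewrite ler_peMr// ltW.
  by rewrite DB; clear -eps_lt1; lra.
have E4 : 4 <= E.
  have : 16 <= E * D by rewrite -ler_pdivrMr.
  by clear -D1 D0; nra.
have E0 : 0 < E by exact: lt_le_trans E4.
(* Rounding moves [K] by less than 1, hence by at most a factor 2 as [E >= 4]. *)
have [kE kE'] : E / 2 <= K%:R /\ K%:R <= 2 * E.
  move: K_def; rewrite powE ltr_norml => /andP[h1 h2].
  by clear -h1 h2 E4; split; lra.
have K2 : 2 <= K%:R :> R by clear -kE E4; lra.
have K0 : 0 < K%:R :> R by exact: lt_le_trans K2.
have K_gt0 : (0 < K)%N by rewrite -(ltr0n R).
have L_ge0 : 0 <= L by exact: le_trans L_ge1.
have enE : E * expR (eps * L) = n by rewrite nE -expRD; congr expR; ring.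
(* Leaves room for both [d] and [5 * r] within the side [m]. *)
have KLn : 100 * (K%:R * L) <= n.
  rewrite -enE; apply: (@le_trans _ _ (E * (200 * L))).
    have := ler_wpM2r L_ge0 kE'; clear; lra.
  rewrite ler_wpM2l ?(ltW E0)//; apply: le_trans L_n _.
  rewrite ler_expR ler_wpM2r// ler_piMl ?(ltW eps_gt0)//; clear; lra.
have KL_ge : E / 2 <= K%:R * L by apply: le_trans kE _; rewrite ler_peMr// ltW.
have DKL : 8 <= D * (K%:R * L).
  have : 16 <= E * D by rewrite -ler_pdivrMr.
  have := ler_wpM2l (ltW D0) KL_ge; clear; lra.
have DKL' : D * (K%:R * L) <= K%:R * L / 200.
  have := ler_wpM2r (mulr_ge0 (ltW K0) L_ge0) D1; clear; lra.
(* The factor 4 is what [uncovered_decay] asks of the window area. *)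
have [|d d0 /andP[dlo dup]] := @nat_square_approx (4 * (K%:R * L)).
  by clear -DKL DKL'; lra.
have [|r r_gt0 /andP[rlo rup]] := @nat_square_approx (D / 4 * (K%:R * L)).
  by clear -DKL; lra.
have dm : (d <= m)%N.
  rewrite -(@leq_exp2r _ _ 2)// -(ler_nat R) -n_def.
  by clear -dup KLn DKL DKL'; lra.
have rm : (5 * r <= m)%N.
  rewrite -(@leq_exp2r _ _ 2)// expnMn -(ler_nat R) natrM -n_def.
  by apply: le_trans KLn; clear -rup DKL DKL'; lra.
pose g := (m %/ (5 * r))%N.
have gm : (g * (5 * r) <= m)%N by exact: leq_trunc_div.
have ng : n <= 100 * (g ^ 2)%:R * (r ^ 2)%:R.
  by rewrite n_def -!natrM ler_nat; exact: grid_count.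
apply: le_trans (prob_max_load M m_gt0 K_gt0 r_gt0 dm gm _ _).
rewrite lerD2l lerN2.
have t1 : (m ^ 2 * K)%:R * (1 - K%:R^-1) ^+ (d ^ 2 * M) <= expR (- L) :> R.
  rewrite natrM; apply: uncovered_decay => //.
  - by apply: le_trans K2; clear; lra.
  - rewrite (_ : 2 * L = L + L); last by ring.
    rewrite expRD -nE -n_def ler_wpM2l ?(ltW n_gt0)//; apply: le_trans KLn.
    apply: (@le_trans _ _ (K%:R * L)); first by rewrite ler_peMr// ltW.
    by clear -DKL DKL'; lra.
  - rewrite natrM; apply: le_trans (_ : (d ^ 2)%:R <= _); last by rewrite ler_peMr.
    by clear -dlo; lra.
have t2 : expR (- ((g ^ 2)%:R * solitary_prob R K M r)) <= expR (- L).
  rewrite ler_expR lerN2 /solitary_prob natrM.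
  apply: solitary_growth kE' _ _ M1 (ltW n_gt0) _ _ enE ng L_n _ => //.
  (* Twice the [25 * r ^ 2 * M] slots of a region is at most [50 * D * B * K * L], which is
     [eps / 4 * K * L] by the choice of [D]. *)
  apply: avoid_ge => //; rewrite expnMn !natrM.
  have : (r ^ 2)%:R * M%:R <= D * (K%:R * L) * B :> R.
    by apply: ler_pM => //; clear -rup; lra.
  have -> : D * (K%:R * L) * B = (D * B) * (K%:R * L) by ring.
  by rewrite DB; clear; lra.
(* As [4d + 1 <= 5d] and [d ^ 2 <= 16 * K * L], means are at most [400 * B * L]; the extra [2 * L]
   in half of [hi] pays for the [expR L] servers. *)
have t3 : (m ^ 2)%:R * expR ((M * d.*2.*2.+1 ^ 2)%:R / K%:R - 2 * (400 * B + 2) * L / 2)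
    <= expR (- L).
  have d5 : ((d.*2.*2.+1) ^ 2)%:R <= (5 ^ 2)%:R * (d ^ 2)%:R :> R.
    by rewrite -natrM ler_nat -expnMn leq_exp2r//; clear -d0; lia.
  have mu : (M * d.*2.*2.+1 ^ 2)%:R / K%:R <= 400 * B * L :> R.
    rewrite ler_pdivrMr// natrM.
    have -> : 400 * B * L * K%:R = B * (400 * (K%:R * L)) by ring.
    by apply: ler_pM => //; clear -d5 dup; lra.
  by rewrite -n_def nE -expRD ler_expR; clear -mu; lra.
(* Half the mean is at least [D / 8 * L], twice the threshold. *)
have t4 : expR (D / 16 * L - (r ^ 2)%:R / K%:R / 2) <= expR (- (D / 16 * L)).
  have : D / 4 * L <= (r ^ 2)%:R / K%:R by rewrite ler_pdivlMr//; clear -rlo; lra.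
  by rewrite ler_expR; clear; lra.
have t5 : expR (- L) <= expR (- (D / 16 * L)).
  by rewrite ler_expR lerN2 ler_piMl//; clear -D1; lra.
(* Halving the exponent absorbs the number 4 of error terms. *)
have t6 : 4 * expR (- (D / 16 * L)) <= expR (- (D / 32 * L)).
  have -> : - (D / 16 * L) = - (D / 32 * L) + - (D / 32 * L) by field.
  rewrite expRD mulrA ger_pMl ?expR_gt0//.
  by rewrite [expR (- _)]expRN ler_pdivrMr ?expR_gt0// mul1r.
by clear -t1 t2 t3 t4 t5 t6; lra.
Qed.

End Asymptotics.

(** * The asymptotic statement *)

Unset Implicit Arguments.

Local Open Scope classical_set_scope.
Local Open Scope ring_scope.

Theorem theorem1 (R : realType) (eps : R) (K M : nat -> nat)
  (eps_gt0 : 0 < eps) (eps_lt1 : eps < 1)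
  (K_def : forall m : nat, `|(K m)%:R - (m ^ 2)%:R `^ (1 - eps)| < 1)
  (M_Theta1 : (fun m : nat => (M m)%:R : R^o) \is 'Theta_\oo(fun=> 1 : R^o))
  (M_le_K : forall m : nat, (0 < m)%N -> (M m <= K m)%N) :
  exists c1 c2 c : R,
    [/\ 0 < c1, 0 < c2, 0 < c &
      \forall m \near \oo,
        1 - 1 / (m ^ 2)%:R `^ c <=
        Prob (@uniform_popularity R (K m))
          (fun w : outcome m (K m) (M m) =>
             c1 * ln ((m ^ 2)%:R : R) <= (max_load w)%:R <= c2 * ln ((m ^ 2)%:R : R))].
Proof.
move: M_Theta1 => /asboolP[[k1 k2] /= /andP[k1_gt0 k2_gt0] M_near].
pose B := Num.max 1 k2.
have B1 : 1 <= B by rewrite le_max lexx.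
pose D : R := eps / (200 * B).
have D0 : 0 < D by rewrite divr_gt0// mulr_gt0//; lra.
(* Growth conditions for [max_load_whp]; where a constant is to be dominated, [1 <= L] removes the
   factor [L]. *)
have [L1 hL1] := @expR_dominates R (1 - eps) (16 / D) ltac:(lra).
have [L2 hL2] := @expR_dominates R (3 / 4 * eps) 200 ltac:(lra).
have [L3 hL3] := @expR_dominates R (D / 32) 4 ltac:(lra).
pose L0 := Num.max 1 (Num.max L1 (Num.max L2 L3)).
exists (D / 16), (2 * (400 * B + 2)), (D / 32); split; [lra|lra|lra|].
(* [m ^ 2] is at least [m], which eventually exceeds [expR L0]. *)
have log_near : \forall m \near \oo, L0 <= ln ((m ^ 2)%:R : R).
  exists (Num.truncn (expR L0)).+1 => // m /= hm.
  have m0 : (0 < m)%N by apply: leq_trans hm.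
  rewrite -ler_expR lnK ?posrE ?ltr0n ?expn_gt0 ?m0//.
  apply: (@le_trans _ _ m%:R); last by rewrite ler_nat -mulnn leq_pmulr.
  apply: le_trans (ltW (truncnS_gt _)) _.
  by rewrite ler_nat.
near=> m.
have m0 : (0 < m)%N by near: m; exists 1%N.
have : L0 <= ln ((m ^ 2)%:R : R) by near: m.
set L := ln _; rewrite /L0 !ge_max => /and4P[L_ge1 /hL1 h1 /hL2 h2 /hL3 h3].
have n0 : 0 < (m ^ 2)%:R :> R by rewrite ltr0n expn_gt0 m0.
have [Mlo Mup] : k1 * `|1| <= `|(M m)%:R : R| /\ `|(M m)%:R : R| <= k2 * `|1|.
  by near: m; exact: M_near.
move: Mlo Mup; rewrite !normr1 !mulr1 normr_nat => Mlo Mup.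
have M0 : (0 < M m)%N by rewrite -(ltr0n R); lra.
(* The inverse power of [m ^ 2] becomes [expR (- (D / 32 * L))]. *)
rewrite div1r -powRN -[X in X `^ _](@lnK R) ?posrE// -expRM [_ * _]mulrC mulNr.
apply: (max_load_whp (B := B) (eps := eps) (n := (m ^ 2)%:R)) => //.
- by rewrite le_max Mup orbT.
- have : 0 < 16 / D by rewrite divr_gt0.
  by clear -h1 L_ge1; nra.
- by clear -h3 L_ge1; lra.
Unshelve. all: by end_near. Qed.
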